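(* Let $A$ and $B$ be semisimple commutative Banach algebras with unit. Suppose that $C$ is a semisimple Tomiyama product of $A$ and $B$. Then $C$ has bounded relative units if and only if both $A$ and $B$ have bounded relative units.
   Context: Banach algebras are over $\mathbb{C}$. For commutative Banach algebras $A$ and $B$ with unit, a Tomiyama product of $A$ and $B$ is the completion of the algebraic tensor product $A\otimes B$ with respect to some submultiplicative cross norm (i.e. $\|a\otimes b\|=\|a\|\,\|b\|$) that is not less than the injective tensor product norm. For a commutative Banach algebra $D$ with unit, $M(D)$ is the set of nonzero multiplicative linear functionals $D\to\mathbb{C}$ with the relative weak-star topology from $D^*$, and $\hat a(\phi)=\phi(a)$. $D$ is semisimple if $a\mapsto\hat a$ is injective. For $\phi\in M(D)$, $J_\phi=\{a\in D:\phi\notin\mathrm{supp}(a)\}$, where $\mathrm{supp}(a)$ is the closure in $M(D)$ of $\{\chi\in M(D):\hat a(\chi)\ne0\}$. $D$ has bounded relative units if for every $\phi\in M(D)$ there exists $m_\phi>0$ such that for each compact subset $K$ of $M(D)\setminus\{\phi\}$ there exists $a\in J_\phi$ with $\hat a(K)\subset\{1\}$ and $\|a\|\le m_\phi$. *)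

(* Defs.v *)
From HB Require Import structures.
From mathcomp Require Import all_boot all_order all_algebra.
From mathcomp Require Import all_classical all_reals topology normedtype.
From mathcomp Require Import complex.

Set Implicit Arguments.
Unset Strict Implicit.
Unset Printing Implicit Defensive.

Import Order.TTheory GRing.Theory Num.Theory.
Import numFieldNormedType.Exports.

Local Open Scope classical_set_scope.
Local Open Scope ring_scope.
Local Open Scope complex_scope.

(* Nonzero commutative Banach algebras with unit; the unit is not required to
   have norm 1. A bare record: Hierarchy Builder refuses a join of
   [GRing.PzSemiRing] and [Num.SemiNormedZmodule] other than [Num.NumDomain].
   The instances on [banach_sort] below provide both structures. *)
Record comBanachAlg (K : numFieldType) := ComBanachAlg {
  banach_space : completeNormedModType K;
  banach_mul : banach_space -> banach_space -> banach_space;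
  banach_one : banach_space;
  banach_mulA : associative banach_mul;
  banach_mulC : commutative banach_mul;
  banach_mul1 : left_id banach_one banach_mul;
  banach_mulDl : left_distributive banach_mul +%R;
  banach_scaleAl : forall (k : K) (x y : banach_space),
    k *: banach_mul x y = banach_mul (k *: x) y;
  banach_one_neq0 : banach_one != 0;
  banach_normM_le : forall x y, `|banach_mul x y| <= `|x| * `|y|
}.

Definition banach_sort (K : numFieldType) (A : comBanachAlg K) : Type :=
  banach_space A.
Coercion banach_sort : comBanachAlg >-> Sortclass.

Section BanachInstances.
Context {K : numFieldType} (A : comBanachAlg K).

HB.instance Definition _ :=
  CompleteNormedModule.copy (banach_sort A) (banach_space A).
HB.instance Definition _ := GRing.Zmodule_isComNzRing.Build (banach_sort A)
  (@banach_mulA K A) (@banach_mulC K A) (@banach_mul1 K A) (@banach_mulDl K A)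
  (@banach_one_neq0 K A).
HB.instance Definition _ := GRing.Lmodule_isLalgebra.Build K (banach_sort A)
  (@banach_scaleAl K A).
HB.instance Definition _ :=
  GRing.Lalgebra_isComAlgebra.Build K (banach_sort A).

End BanachInstances.

Section MaximalIdealSpace.
Context {K : numFieldType} (D : comBanachAlg K).

(* The weak-star topology is the topology of pointwise convergence, here the
   one of [{ptws D -> K^o}]. Continuity of the functionals is not demanded: it
   is automatic on a Banach algebra. *)
Definition characters : set {ptws D -> K^o} :=
  [set phi | [/\ scalar phi,
                 {morph (phi : D -> K) : a b / a * b} &
                 exists a, phi a != 0]].

(* [set_type] carries the relative topology. *)
Definition maxspace : Type := set_type characters.
HB.instance Definition _ := Topological.copy maxspace (set_type characters).

Definition gelfand (a : D) (phi : maxspace) : K := \val phi a.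

Definition semisimple : Prop := injective gelfand.

Definition supp (a : D) : set maxspace :=
  closure [set chi | gelfand a chi != 0].

Definition Jideal (phi : maxspace) : set D := [set a | ~ supp a phi].

(* When [K] is [R[i]], [0 < m] forces [m] to be a (positive) real number. *)
Definition bounded_relative_units : Prop :=
  forall phi : maxspace, exists2 m : K, 0 < m &
    forall L : set maxspace, compact L -> L `<=` ~` [set phi] ->
      exists a : D, [/\ Jideal phi a,
                        gelfand a @` L `<=` [set 1] &
                        `|a| <= m].

End MaximalIdealSpace.

Arguments characters {K} D _.

Section TensorProduct.
Context {K : numFieldType}.

Definition is_tensor_product (A B T : lmodType K) (ten : A -> B -> T) : Prop :=
  bilinear_for *:%R *:%R ten /\
  forall (W : lmodType K) (f : A -> B -> W), bilinear_for *:%R *:%R f ->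
    exists! g : T -> W, linear g /\ forall a b, g (ten a b) = f a b.

Definition is_tensor_algebra (A B T : comAlgType K) (ten : A -> B -> T) :
    Prop :=
  [/\ is_tensor_product ten,
      ten 1 1 = 1 &
      forall a a' b b', ten a b * ten a' b' = ten (a * a') (b * b')].

Definition is_norm (T : lmodType K) (N : T -> K) : Prop :=
  [/\ forall s t, N (s + t) <= N s + N t,
      forall k t, N (k *: t) = `|k| * N t &
      forall t, N t = 0 -> t = 0].

Definition dual_unit_ball (V : normedModType K) : set (V -> K) :=
  [set f | scalar f /\ forall v, `|f v| <= `|v|].

End TensorProduct.

Section Tomiyama.
Context {R : realType}.

(* Norms on [R[i]]-modules take values in [R[i]]; [r%:C] brings them back to
   [R], where suprema exist. *)
Definition injective_norm (A B : normedModType R[i]) (T : lmodType R[i])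
    (ten : A -> B -> T) (t : T) : R :=
  sup [set r : R | exists f g (s : seq (A * B)),
    [/\ dual_unit_ball f, dual_unit_ball g,
        t = \sum_(p <- s) ten p.1 p.2 &
        r%:C = `|\sum_(p <- s) f p.1 * g p.2|]].

Definition is_tomiyama_norm (A B : comBanachAlg R[i]) (T : comAlgType R[i])
    (ten : A -> B -> T) (N : T -> R[i]) : Prop :=
  [/\ is_norm N,
      forall s t, N (s * t) <= N s * N t,
      forall a b, N (ten a b) = `|a| * `|b| &
      forall t, (injective_norm ten t)%:C <= N t].

Definition is_completion (T : comAlgType R[i]) (N : T -> R[i])
    (C : comBanachAlg R[i]) : Prop :=
  exists2 iota : {lrmorphism T -> C},
    forall t, `|iota t| = N t & dense (range iota).

Definition tomiyama_product (A B C : comBanachAlg R[i]) : Prop :=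
  exists (T : comAlgType R[i]) (ten : A -> B -> T) (N : T -> R[i]),
    [/\ is_tensor_algebra ten, is_tomiyama_norm ten N & is_completion N C].

End Tomiyama.

(* Main.v *)
Require Import Defs.
From HB Require Import structures.
From mathcomp Require Import all_boot all_order all_algebra.
From mathcomp Require Import all_classical all_reals topology normedtype.
From mathcomp Require Import sequences complex ring lra.

(* A character psi of B gives the slice map a (x) b |-> psi(b) a, which by
   Hahn-Banach is bounded for the injective norm and hence extends to a
   contractive homomorphism S of C onto A. Pulling characters back along S
   embeds M(A) in M(C), so S carries relative units of C to relative units of A
   with the same bound; semisimplicity is only used to see that M(B) is not
   empty. Conversely a character theta of C is determined by its restrictions
   phi, psi to A and B, so a compact L not containing theta is covered by two
   compact sets on which the first, resp. the second, restriction avoids phi,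
   resp. psi. If a and b are relative units for their projections, then
   1 - (1 - a (x) 1)(1 - 1 (x) b) is 1 on L and vanishes near theta. *)

Set Implicit Arguments.
Unset Strict Implicit.
Unset Printing Implicit Defensive.

Import Order.TTheory GRing.Theory Num.Theory.
Import numFieldNormedType.Exports.

Local Open Scope classical_set_scope.
Local Open Scope ring_scope.
Local Open Scope complex_scope.

(** * Real moduli, limits and the geometric series *)

Lemma Re_normK {R : realType} (V : normedModType R[i]) (x : V) :
  (complex.Re `|x|)%:C = `|x|.
Proof. by rewrite RRe_real// normr_real. Qed.

Lemma gtc0_Re {R : realType} (e : R[i]) :
  0 < e -> exists2 d : R, 0 < d & e = d%:C.
Proof.
move=> e0; have eE : (complex.Re e)%:C = e by rewrite RRe_real// gtr0_real.
by exists (complex.Re e); rewrite -?ltcR eE.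
Qed.

(** The rate [e] passes from the Cauchy estimate to the limit, so later estimates can be
    explicit. *)
Lemma cauchy_limit {R : realType} (V : completeNormedModType R[i])
    (u : nat -> V) (e : nat -> R) :
  e @ \oo --> 0 ->
  (forall n m, (n <= m)%N -> `|u n - u m| <= (e n)%:C) ->
  exists l : V, forall n, `|l - u n| <= (e n)%:C.
Proof.
move=> e_cvg0 u_le.
have e_lt d : 0 < d -> exists N, e N < d.
  move=> d0; have /cvgrPdist_lt/(_ _ d0)[N _ /(_ N (leqnn _))] := e_cvg0.
  rewrite sub0r normrN => /= eN.
  by exists N; apply: le_lt_trans (ler_norm _) eN.
have u_cvg : cvg (u @ \oo).
  apply/cauchy_cvgP/cauchy_exP => _ /gtc0_Re[d d0 ->].
  have [N eN] := e_lt _ d0; exists (u N); exists N => // n /= Nn.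
  rewrite -ball_normE/=; apply: le_lt_trans (u_le _ _ Nn) _.
  by rewrite ltcR.
exists (lim (u @ \oo)) => n; rewrite -Re_normK lecR.
apply/ler_addgt0Pr => d d0.
have d0' : 0 < d%:C :> R[i] by rewrite ltcR.
have /cvgrPdist_lt/(_ _ d0')[N _ uN] := u_cvg.
(* The index [maxn N n] is both close to the limit and beyond [n]. *)
have /uN/= := leq_maxl N n => lim_uN.
rewrite -lecR Re_normK rmorphD/=.
rewrite -(subrKA (u (maxn N n))); apply: le_trans (ler_normD _ _) _.
by rewrite addrC lerD ?(ltW lim_uN)// distrC u_le ?leq_maxr.
Qed.

(** The element is $x + x^2 + \dots$, the limit of the iterates of $b \mapsto x + xb$ from 0. In
    this form a character with value 1 at [x] is contradicted at once. *)
Lemma geometric_fixpoint {R : realType} {D : comBanachAlg R[i]} (x : D) :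
  `|x| < 1 -> exists b : D, b = x + x * b.
Proof.
rewrite -Re_normK -[1]/((1 : R)%:C) ltcR; set q := complex.Re _ => q1.
have xq : `|x| = q%:C by rewrite Re_normK.
have q0 : 0 <= q by rewrite -lecR -xq normr_ge0.
(* [M] is $\sum_{n \ge 1} q^n$; since $M = q + qM$, it bounds every iterate by induction. *)
pose u n := iter n (fun b => x + x * b) 0; pose M := q / (1 - q).
have M0 : 0 <= M by rewrite divr_ge0// subr_ge0 ltW.
have u_le m : `|u m| <= M%:C.
  elim: m => [|m IHm] /=; first by rewrite normr0 lecR.
  apply: le_trans (ler_normD _ _) _; rewrite xq.
  have -> : M = q + q * M by rewrite /M; field; lra.
  rewrite rmorphD rmorphM/= lerD2l; apply: le_trans (banach_normM_le _ _) _.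
  by rewrite xq ler_pM ?normr_ge0 ?lecR.
have u_cauchy n m : (n <= m)%N -> `|u n - u m| <= (M * q ^+ n)%:C.
  elim: n m => [|n IHn] [|m]//; first by rewrite subrr normr0 mulr1 lecR.
    by rewrite sub0r normrN mulr1 u_le.
  rewrite ltnS => /IHn {}IHn /=.
  rewrite opprD addrACA subrr add0r -mulrBr exprS mulrCA rmorphM/=.
  apply: le_trans (banach_normM_le _ _) _.
  by rewrite xq ler_pM ?normr_ge0 ?lecR.
have e_cvg0 : (fun n => M * q ^+ n) @ \oo --> 0.
  by rewrite -(mulr0 M); apply: cvgMl_tmp; apply: cvg_expr; rewrite ger0_norm.
have [b ub] := cauchy_limit e_cvg0 u_cauchy.
exists b; apply/eqP; rewrite -subr_eq0 -normr_le0.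
rewrite -Re_normK lecR; apply/ler_addgt0Pr => d d0.
have d20 : 0 < d / 2 by lra.
have /cvgrPdist_lt/(_ _ d20)[N _ /(_ N (leqnn _))] := e_cvg0.
rewrite sub0r normrN add0r ger0_norm; last by rewrite mulr_ge0 ?exprn_ge0.
move=> /= eN.
rewrite -lecR Re_normK.
(* Compare through $u_{N+1} = x + x u_N$; each summand has norm at most $M q^N$. *)
have -> : b - (x + x * b) = (b - u N.+1) + x * (u N - b).
  by rewrite -[u N.+1]/(x + x * u N) mulrBr !opprD !addrA subrK.
apply: le_trans (_ : (2 * (M * q ^+ N))%:C <= _); last by rewrite lecR; lra.
rewrite mulr_natl mulr2n rmorphD/=; apply: le_trans (ler_normD _ _) _.
apply: lerD.
  apply: le_trans (ub N.+1) _.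
  by rewrite lecR ler_wpM2l// exprS ler_piMl ?exprn_ge0// ltW.
apply: le_trans (banach_normM_le _ _) _.
rewrite xq -[leRHS]mul1r ler_pM ?lecR//; last by rewrite distrC ub.
exact: ltW.
Qed.

(** * The Hahn-Banach theorem *)

Section HahnBanach.
Context {R : realType}.

(** * Sublinear functionals over the real scalars *)

Section Sublinear.
Context {V : lmodType R[i]}.
Implicit Types (p q : V -> R) (x y : V) (r t : R).

(** Homogeneity is only an inequality, which is easier to check for infima; [sublinearZ] recovers
    equality. *)
Definition sublinear p :=
  (forall x y, p (x + y) <= p x + p y) /\
  (forall r x, 0 <= r -> p (r%:C *: x) <= r * p x).

Lemma sublinear0 p : sublinear p -> p 0 = 0.
Proof.
move=> [pD pZ]; apply/eqP; rewrite eq_le; apply/andP; split.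
  by have := pZ 0 0 (lexx _); rewrite scaler0 mul0r.
by have := pD 0 0; rewrite addr0 -{1}[p 0]addr0 lerD2l.
Qed.

Lemma sublinearN p x : sublinear p -> - p (- x) <= p x.
Proof.
move=> sp; have [pD _] := sp.
by have := pD x (- x); rewrite subrr (sublinear0 sp) -lerBlDr sub0r.
Qed.

Lemma sublinearZ p r x : sublinear p -> 0 <= r -> p (r%:C *: x) = r * p x.
Proof.
move=> sp; have [_ pZ] := sp; rewrite le0r => /predU1P[->|r0].
  by rewrite scale0r mul0r sublinear0.
apply/eqP; rewrite eq_le (pZ _ _ (ltW r0))/= -ler_pdivlMl//.
have := pZ r^-1 (r%:C *: x); rewrite invr_ge0 ltW// => /(_ isT).
by rewrite scalerA -rmorphM mulVf ?gt_eqF// scale1r.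
Qed.

(* The largest sublinear minorant of p with value at most - p y at - y. *)
Definition sublinear_push p y x :=
  inf [set p (x + t%:C *: y) - t * p y | t in [set t | 0 <= t]].

Section Push.
Variables (p : V -> R) (y : V) (sp : sublinear p).

Lemma sublinear_push_le x t :
  0 <= t -> sublinear_push p y x <= p (x + t%:C *: y) - t * p y.
Proof.
move=> t0; apply: ge_inf; last by exists t.
(* Subadditivity gives $s\,p(y) = p(sy) \le p(x + sy) + p(-x)$, so the infimum is over a set bounded
   below. *)
exists (- p (- x)) => _ [s /= s0 <-].
have [pD _] := sp.
have := pD (x + s%:C *: y) (- x).
by rewrite addrAC subrr add0r (sublinearZ _ sp)//; lra.
Qed.

Lemma le_sublinear_push x z :
  (forall t, 0 <= t -> z <= p (x + t%:C *: y) - t * p y) ->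
  z <= sublinear_push p y x.
Proof.
move=> zp; apply: lb_le_inf.
  by exists (p (x + 0%:C *: y) - 0 * p y), 0 => /=.
by move=> _ [t /= t0 <-]; exact: zp.
Qed.

Lemma sublinear_push_le_id x : sublinear_push p y x <= p x.
Proof.
by have := @sublinear_push_le x 0 (lexx _); rewrite scale0r addr0 mul0r subr0.
Qed.

Lemma sublinear_pushN : sublinear_push p y (- y) <= - p y.
Proof.
have := @sublinear_push_le (- y) 1 ler01.
by rewrite scale1r addNr (sublinear0 sp) mul1r sub0r.
Qed.

(** Parameters [t] for [x] and [s] for [x'] combine to [t + s] for [x + x'], and scaling [x] by [r]
    turns [t] into [r * t]. *)
Lemma sublinear_push_sublinear : sublinear (sublinear_push p y).
Proof.
have [pD pZ] := sp; split=> [x x'|r x r0].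
  rewrite -lerBlDr; apply: le_sublinear_push => t t0.
  rewrite lerBlDr [leRHS]addrC -lerBlDr; apply: le_sublinear_push => s s0.
  have := @sublinear_push_le (x + x') (t + s) (addr_ge0 t0 s0).
  rewrite rmorphD scalerDl addrACA; have := pD (x + t%:C *: y) (x' + s%:C *: y).
  lra.
move: r0; rewrite le0r => /predU1P[->|r0].
  rewrite scale0r mul0r; apply: (le_trans (sublinear_push_le_id _)).
  by rewrite sublinear0.
rewrite -ler_pdivrMl//; apply: le_sublinear_push => t t0.
rewrite ler_pdivrMl//.
have := @sublinear_push_le (r%:C *: x) (r * t) (mulr_ge0 (ltW r0) t0).
have := pZ r (x + t%:C *: y) (ltW r0).
rewrite scalerDr scalerA -rmorphM/=; lra.
Qed.

End Push.

(** Zorn's lemma on the sublinear minorants of [p0]: the pointwise infimum of a chain is again one,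
    being bounded below by $-p_0(-x)$. *)
Lemma exists_minimal_sublinear p0 : sublinear p0 ->
  exists p, [/\ sublinear p, forall x, p x <= p0 x &
    forall q, sublinear q -> (forall x, q x <= p x) -> forall x, q x = p x].
Proof.
move=> sp0; pose T := {p | sublinear p /\ forall x, p x <= p0 x}.
(* The order is reversed, so that a maximal element is a minimal functional. *)
pose le (p q : T) := `[< forall x, sval q x <= sval p x >].
have lbT (p : T) x : - p0 (- x) <= sval p x.
  case: p => p [sp pp0] /=.
  by apply: le_trans (sublinearN _ sp); rewrite lerN2.
have [||||[p [sp pp0]] pmin] := @Zorn T le.
- by move=> p; apply/asboolP.
- move=> p q r /asboolP pq /asboolP qr; apply/asboolP => x.
  exact: le_trans (qr x) (pq x).
- move=> [p sp] [q sq] /asboolP/= pq /asboolP/= qp; apply: eq_exist.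
  by apply/funext => x; apply/eqP; rewrite eq_le pq qp.
- move=> A Atot; have [->|/set0P[a Aa]] := eqVneq A set0.
    by exists (exist _ p0 (conj sp0 (fun=> lexx _))).
  pose q x := inf [set sval p x | p in A].
  have q_le (p : T) x : A p -> q x <= sval p x.
    move=> Ap; apply: ge_inf; last by exists p.
    by exists (- p0 (- x)) => _ [r _ <-].
  have q_ge x z : (forall p : T, A p -> z <= sval p x) -> z <= q x.
    move=> zp; apply: lb_le_inf; first by exists (sval a x), a.
    by move=> _ [p Ap <-]; exact: zp.
  have sq : sublinear q.
    split=> [x y|r x r0].
      rewrite -lerBlDr; apply: (q_ge) => p Ap.
      rewrite lerBlDr [leRHS]addrC -lerBlDr.
      apply: (q_ge) => p' Ap'; rewrite lerBlDr.
      (* Of two members of the chain, the smaller one is subadditive and is dominated by both. *)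
      have [/asboolP pp'|/asboolP pp'] := Atot _ _ Ap Ap'.
        apply: (le_trans (q_le p' _ Ap')).
        have := (svalP p').1.1 x y; have := pp' x; lra.
      apply: (le_trans (q_le p _ Ap)).
      have := (svalP p).1.1 x y; have := pp' y; lra.
    move: r0; rewrite le0r => /predU1P[->|r0].
      rewrite scale0r mul0r; apply: (le_trans (q_le a _ Aa)).
      by rewrite (sublinear0 (svalP a).1).
    rewrite -ler_pdivrMl//; apply: (q_ge) => p Ap; rewrite ler_pdivrMl//.
    by apply: (le_trans (q_le p _ Ap)); exact: ((svalP p).1.2 _ _ (ltW r0)).
  have qp0 x : q x <= p0 x.
    by apply: (le_trans (q_le a _ Aa)); exact: (svalP a).2.
  exists (exist _ q (conj sq qp0)) => p Ap; apply/asboolP => x /=.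
  exact: q_le.
exists p; split=> // q sq qp x.
have qp0 y : q y <= p0 y := le_trans (qp y) (pp0 y).
have := pmin (exist _ q (conj sq qp0)).
by move=> /(_ (asboolT qp)) /(congr1 sval) /= ->.
Qed.

(* By minimality p equals its push along every y, which gives superadditivity. *)
Lemma minimal_sublinear_linear p : sublinear p ->
  (forall q, sublinear q -> (forall x, q x <= p x) -> forall x, q x = p x) ->
  (forall x y, p (x + y) = p x + p y) /\
  (forall r x, p (r%:C *: x) = r * p x).
Proof.
move=> sp pmin; have pD x y : p (x + y) = p x + p y.
  apply/eqP; rewrite eq_le sp.1/=.
  have := @sublinear_push_le p y sp x 1 ler01.
  rewrite (pmin _ (sublinear_push_sublinear y sp)); last first.
    exact: sublinear_push_le_id.
  by rewrite scale1r mul1r; lra.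
have pN x : p (- x) = - p x.
  by have := pD x (- x); rewrite subrr (sublinear0 sp); lra.
split=> // r x; have [r0|r0] := leP 0 r; first exact: sublinearZ.
rewrite -[r]opprK rmorphN scaleNr pN sublinearZ ?mulNr//.
by rewrite oppr_ge0 ltW.
Qed.

(** A minimal functional below the push along [a] is linear and satisfies $u(-a) \le -p(a)$, hence
    $u(a) \ge p(a)$. *)
Lemma hahn_banach_real p a : sublinear p -> exists u : V -> R,
  [/\ forall x y, u (x + y) = u x + u y,
      forall r x, u (r%:C *: x) = r * u x,
      forall x, u x <= p x & u a = p a].
Proof.
move=> sp; have [u [su up umin]] :=
  exists_minimal_sublinear (sublinear_push_sublinear a sp).
have [uD uZ] := minimal_sublinear_linear su umin.
have {}up' x : u x <= p x.
  by apply: le_trans (up x) _; exact: sublinear_push_le_id.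
exists u; split=> //; apply/eqP; rewrite eq_le up'/=.
have := le_trans (up (- a)) (sublinear_pushN a sp).
have := uD a (- a); rewrite subrr (sublinear0 su); lra.
Qed.

End Sublinear.
End HahnBanach.

(** * Norming functionals over the complex scalars *)

Section HahnBanachComplex.
Context {R : realType}.

Lemma hahn_banach (V : normedModType R[i]) (a : V) :
  exists2 f : V -> R[i], dual_unit_ball f & `|a| <= `|f a|.
Proof.
pose p (x : V) : R := complex.Re `|x|.
have sp : sublinear p.
  split=> [x y|r x r0].
    by rewrite -lecR rmorphD/= !Re_normK ler_normD.
  by rewrite -lecR rmorphM/= !Re_normK normrZ ger0_norm// ler0c.
have [u [uD uZ up ua]] := hahn_banach_real a sp.
(* The usual complexification: $f(x) = u(x) - i\,u(ix)$ is complex linear with real part [u]. *)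
pose f (x : V) : R[i] := u x -i* u ('i%C *: x).
have uC (k : R[i]) x :
    u (k *: x) = complex.Re k * u x + complex.Im k * u ('i%C *: x).
  have kE : k = (complex.Re k)%:C + (complex.Im k)%:C * 'i%C.
    by rewrite mulrC; exact: complexE.
  by rewrite {1}kE scalerDl uD uZ -scalerA uZ.
have fZ k x : f (k *: x) = k * f x.
  rewrite /f scalerA (uC k) (uC ('i%C * k)); case: k => r s /=.
  by apply/eqP; rewrite eq_complex/=; apply/andP; split; apply/eqP; ring.
have f_scalar : scalar f.
  move=> k x y; rewrite -fZ /f scalerDr !uD.
  by apply/eqP; rewrite eq_complex/= opprD !eqxx.
exists f.
  split=> // x; have [->|fx0] := eqVneq (f x) 0; first by rewrite normr0.
  (* Rotating [x] by the unimodular [e] makes the value of [f] real, so it equals $u(ex) \le \|ex\|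
     = \|x\|$. *)
  pose e := `|f x| / f x.
  have e1 : `|e| = 1 by rewrite normrM normr_id normfV divff// normr_eq0.
  have := fZ e x; rewrite mulfVK// => /(congr1 (@complex.Re R)) fex.
  rewrite -[leRHS]mul1r -e1 -normrZ -[leRHS]Re_normK.
  rewrite -[leLHS]RRe_real ?normr_real//.
  by rewrite lecR -fex; exact: up.
apply: le_trans (normc_ge_Re _) => /=.
by rewrite -Re_normK lecR -[leLHS]ua ler_norm.
Qed.

End HahnBanachComplex.

(** * Characters of a Banach algebra *)

Section Characters.
Context {R : realType} {D : comBanachAlg R[i]}.

Lemma gelfand_scalar (phi : maxspace D) : scalar (fun a : D => gelfand a phi).
Proof. by have [] := set_mem (valP phi). Qed.

Lemma gelfandM (phi : maxspace D) a b :
  gelfand (a * b) phi = gelfand a phi * gelfand b phi.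
Proof. by have [_ phiM _] := set_mem (valP phi); apply: phiM. Qed.

Lemma gelfandD (phi : maxspace D) a b :
  gelfand (a + b) phi = gelfand a phi + gelfand b phi.
Proof. by have := gelfand_scalar phi 1 a b; rewrite scale1r mul1r. Qed.

Lemma gelfand0 (phi : maxspace D) : gelfand 0 phi = 0.
Proof. by apply: (addrI (gelfand 0 phi)); rewrite -gelfandD !addr0. Qed.

Lemma gelfandZ (phi : maxspace D) k a :
  gelfand (k *: a) phi = k * gelfand a phi.
Proof. by have := gelfand_scalar phi k a 0; rewrite addr0 gelfand0 addr0. Qed.

Lemma gelfandN (phi : maxspace D) a : gelfand (- a) phi = - gelfand a phi.
Proof. by rewrite -scaleN1r gelfandZ mulN1r. Qed.

Lemma gelfandB (phi : maxspace D) a b :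
  gelfand (a - b) phi = gelfand a phi - gelfand b phi.
Proof. by rewrite gelfandD gelfandN. Qed.

Lemma gelfand1 (phi : maxspace D) : gelfand 1 phi = 1.
Proof.
have [a phia0] : exists a, gelfand a phi != 0 by have [] := set_mem (valP phi).
by apply: (mulfI phia0); rewrite -gelfandM !mulr1.
Qed.

(** Otherwise $x = \phi(a)^{-1} a$ has norm below 1 and $\phi(x) = 1$; applying $\phi$ to $b = x +
    xb$ gives $\phi(b) = 1 + \phi(b)$. *)
Lemma gelfand_norm_le (phi : maxspace D) a : `|gelfand a phi| <= `|a|.
Proof.
rewrite real_leNgt ?normr_real//; apply/negP => lt_a.
have phia0 : gelfand a phi != 0 by rewrite -normr_gt0; apply: le_lt_trans lt_a.
have /geometric_fixpoint[b] : `|(gelfand a phi)^-1 *: a| < 1.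
  by rewrite normrZ normfV -ltr_pdivlMl ?invr_gt0 ?normr_gt0// invrK mulr1.
move=> /(congr1 (fun a : D => gelfand a phi)).
rewrite gelfandD gelfandM gelfandZ mulVf// mul1r => /eqP.
by rewrite -subr_eq subrr eq_sym oner_eq0.
Qed.

End Characters.

(** * Slice maps on Tomiyama products *)

Section TensorSpan.
Context {K : numFieldType} {A B T : lmodType K}.

(** A predicate, so that the span can be made a module of its own and serve as a target in the
    universal property. *)
Definition tensor_span (ten : A -> B -> T) : {pred T} :=
  fun t => `[< exists s : seq (K * (A * B)),
    t = \sum_(p <- s) p.1 *: ten p.2.1 p.2.2 >].

Lemma tensor_span_submod_closed ten : submod_closed (tensor_span ten).
Proof.
split; first by apply/asboolP; exists [::]; rewrite big_nil.
move=> k t1 t2 /asboolP[s1 ->] /asboolP[s2 ->]; apply/asboolP.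
exists ([seq (k * p.1, p.2) | p <- s1] ++ s2).
rewrite big_cat big_map scaler_sumr/=; congr (_ + _).
by apply: eq_bigr => p _; rewrite scalerA.
Qed.

HB.instance Definition _ ten :=
  GRing.isSubmodClosed.Build K T (tensor_span ten)
    (tensor_span_submod_closed ten).

Record tensor_span_of ten := TensorSpanOf {
  tensor_span_val : T;
  tensor_span_valP : tensor_span_val \in tensor_span ten }.

HB.instance Definition _ ten :=
  [isSub of tensor_span_of ten for @tensor_span_val ten].
HB.instance Definition _ ten := [Choice of tensor_span_of ten by <:].
HB.instance Definition _ ten :=
  [SubChoice_isSubLmodule of tensor_span_of ten by <:].

(* The universal property factors the identity of T through the span. *)
Lemma tensor_product_span ten (t : T) : is_tensor_product ten ->
  exists s : seq (A * B), t = \sum_(p <- s) ten p.1 p.2.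
Proof.
move=> [[tenl tenr] univ].
have tenP a b : ten a b \in tensor_span ten.
  by apply/asboolP; exists [:: (1, (a, b))]; rewrite big_seq1 scale1r.
pose f a b := TensorSpanOf (tenP a b).
have f_bilinear : bilinear_for *:%R *:%R f.
  split=> [b k a a'|a k b b']; apply: val_inj => /=.
    exact: tenl.
  exact: tenr.
have [g [[g_lin gf] _]] := univ _ _ f_bilinear.
have [h [_ h_uniq]] := univ T ten (tenl, tenr).
have hE : val \o g = id.
  transitivity h; first apply/esym/h_uniq; last apply/h_uniq.
    split=> [k x y|a b] /=; last by rewrite gf.
    by rewrite g_lin.
  by split.
have /asboolP[s ts] : t \in tensor_span ten.
  by rewrite -[t]/(id t) -hE; exact: valP.
exists [seq (p.1 *: p.2.1, p.2.2) | p <- s]; rewrite big_map ts.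
apply: eq_bigr => p _ /=.
(* The instance at zero yields $0 \otimes b = 0$; the other then absorbs the coefficient into the
   first factor. *)
have := tenl p.2.2 p.1 p.2.1 0; have := tenl p.2.2 1 0 0.
rewrite /= !scale1r !addr0 => /eqP; rewrite -subr_eq subrr => /eqP <-.
by rewrite addr0.
Qed.

End TensorSpan.

(** * Extension of contractions by density *)

Section Extension.
Context {R : realType}.

Lemma le_norm_addgt0 (V W : normedModType R[i]) (x : V) (y : W) (M : R) :
  (forall e, 0 < e -> `|x| <= `|y| + (M * e)%:C) -> `|x| <= `|y|.
Proof.
move=> xy; rewrite -[leLHS]Re_normK -[leRHS]Re_normK lecR.
apply/ler_addgt0Pr => d d0.
have Mp : 0 < `|M| + 1 by rewrite ltr_wpDl.
have e0 : 0 < d / (`|M| + 1) by rewrite divr_gt0.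
rewrite -lecR rmorphD/= !Re_normK; apply: le_trans (xy _ e0) _.
rewrite lerD2l lecR mulrA ler_pdivrMr// mulrC ler_wpM2l ?ltW//.
by have := ler_norm M; lra.
Qed.

Lemma norm_small_eq0 (V : normedModType R[i]) (x : V) (M : R) :
  (forall e, 0 < e -> `|x| <= (M * e)%:C) -> x = 0.
Proof.
move=> xM; apply/eqP; rewrite -normr_le0 -(normr0 V).
by apply: (le_norm_addgt0 (M := M)) => e e0; rewrite normr0 add0r xM.
Qed.

Lemma dense_norm_lt (V : normedModType R[i]) (T : Type) (i : T -> V)
    (c : V) (e : R) :
  dense (range i) -> 0 < e -> exists t, `|c - i t| < e%:C.
Proof.
move=> di e0; have e0' : 0 < e%:C :> R[i] by rewrite ltcR.
have [||x [/= be [t _ tx]]] := di (ball c e%:C).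
- by exists c; apply: ballxx.
- exact: ball_open.
- by exists t; rewrite tx; move: be; rewrite -ball_normE.
Qed.

(** The single estimate on [S] says both that it extends [g] along [i] and that it is contractive;
    the algebraic laws are later deduced from it. *)
Lemma dense_extension (T : lmodType R[i]) (V W : completeNormedModType R[i])
    (i : {linear T -> V}) (g : {linear T -> W}) :
  dense (range i) -> (forall t, `|g t| <= `|i t|) ->
  exists S : V -> W, forall c t, `|S c - g t| <= `|c - i t|.
Proof.
move=> di gi.
suff /choice[S SP] c : exists w, forall t, `|w - g t| <= `|c - i t|.
  by exists S.
(* For $n \le m$ the images of [u n] and [u m] differ by at most $1/(n+1) + 1/(m+1) \le 2/(n+1)$. *)
pose e n : R := 2 * n.+1%:R^-1.
have /choice[u uP] n : exists t, `|c - i t| < (n.+1%:R^-1 : R)%:C.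
  by apply: dense_norm_lt; rewrite ?invr_gt0.
have gB s t : `|g s - g t| <= `|c - i s| + `|c - i t|.
  rewrite -linearB; apply: le_trans (gi _) _; rewrite linearB.
  by rewrite -(subrKA c) (le_trans (ler_normD _ _))// [`|i s - c|]distrC.
have e_cvg0 : e @ \oo --> 0.
  by rewrite -(mulr0 2); apply: cvgMl_tmp; exact: cvg_harmonic.
have [w wP] : exists w : W, forall n, `|w - g (u n)| <= (e n)%:C.
  apply: cauchy_limit => // n m nm; apply: le_trans (gB _ _) _.
  rewrite /e mulr_natl mulr2n rmorphD/= lerD ?(ltW (uP _))//.
  apply: le_trans (ltW (uP m)) _.
  by rewrite lecR lef_pV2 ?posrE// ler_nat ltnS.
exists w => t; apply: (le_norm_addgt0 (M := 1)) => d d0.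
(* The total error is $1/(N+1)$ from [u N] plus $2/(N+1)$ from [e N]. *)
have d30 : 0 < d / 3 by lra.
have /cvgrPdist_lt/(_ _ d30)[N _ /(_ N (leqnn _))] := @cvg_harmonic R.
rewrite sub0r normrN => /= /(le_lt_trans (ler_norm _)) Nd.
rewrite -(subrKA (g (u N))); apply: le_trans (ler_normD _ _) _.
rewrite addrC; apply: le_trans (lerD (gB _ _) (wP _)) _.
rewrite addrAC addrC lerD2l.
apply: le_trans (lerD (ltW (uP N)) (lexx _)) _.
rewrite -rmorphD lecR /e; move: Nd; rewrite /harmonic/=.
by move: (N.+1%:R^-1) => z zd; lra.
Qed.

End Extension.

Lemma linear_bundle {K : pzRingType} (U V : lmodType K) (g : U -> V) :
  linear g -> exists h : {linear U -> V}, h =1 g.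
Proof.
move=> g_lin; pose gL := GRing.isLinear.Build K U V *:%R g g_lin.
pose h : {linear U -> V} := HB.pack g gL.
by exists h.
Qed.

(** * The injective norm and the symmetry of the product *)

Section InjectiveNorm.
Context {R : realType} {A B : normedModType R[i]} {T : lmodType R[i]}.
Variable ten : A -> B -> T.

(** The left side is one of the values under the supremum; the work is to bound these values, by
    $\sum \|a\|\,\|b\|$ over [s]. *)
Lemma injective_norm_ge (f : A -> R[i]) (g : B -> R[i]) (s : seq (A * B)) :
  is_tensor_product ten -> dual_unit_ball f -> dual_unit_ball g ->
  `|\sum_(p <- s) f p.1 * g p.2| <=
    (injective_norm ten (\sum_(p <- s) ten p.1 p.2))%:C.
Proof.
move=> [_ univ] f1 g1; rewrite -[leLHS]RRe_real ?normr_real// lecR.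
apply: ub_le_sup; last first.
  by exists f, g, s; split=> //; rewrite RRe_real ?normr_real.
exists (complex.Re (\sum_(p <- s) `|p.1| * `|p.2|)) => r.
move=> [f' [g' [s' [[f'_lin f'1] [g'_lin g'1] ss' rE]]]].
pose h a b : R[i]^o := f' a * g' b.
have h_bil : bilinear_for *:%R *:%R h.
  split=> [b k a a'|a k b b'] /=; rewrite /h ?f'_lin ?g'_lin.
    by rewrite mulrDl -mulrA.
  by rewrite mulrDr mulrCA.
(* The functional induced by $f' \otimes g'$ shows that the value does not depend on the
   representation, so [s'] may be replaced by [s]. *)
have [H0 [[/linear_bundle[H HH0] H0h] _]] := univ _ _ h_bil.
have HE (s0 : seq (A * B)) :
    H (\sum_(p <- s0) ten p.1 p.2) = \sum_(p <- s0) f' p.1 * g' p.2.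
  by rewrite linear_sum; apply: eq_bigr => p _; rewrite HH0 H0h.
rewrite -lecR rE -HE -ss' HE RRe_real; last first.
  by rewrite ger0_real// sumr_ge0// => p _; rewrite mulr_ge0.
apply: le_trans (ler_norm_sum _ _ _) _; apply: ler_sum => p _.
by rewrite normrM ler_pM.
Qed.

End InjectiveNorm.

Lemma tomiyama_product_sym {R : realType} (A B C : comBanachAlg R[i]) :
  tomiyama_product A B C -> tomiyama_product B A C.
Proof.
move=> [T [ten [N [[[[tenl tenr] univ] ten1 tenM] [Nn NM Nx Ninj] cC]]]].
exists T, (fun b a => ten a b), N; split=> //.
  split=> //.
  split; first by split=> [a|b]; [exact: tenr|exact: tenl].
  move=> W f [fl fr].
  have f_bil : bilinear_for *:%R *:%R (fun a b => f b a).
    by split=> [b|a]; [exact: fr|exact: fl].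
  have [g [[g_lin gf] g_uniq]] := univ _ _ f_bil.
  by exists g; split=> // g' [? ?]; apply: g_uniq.
split=> // [b a|t]; first by rewrite Nx mulrC.
suff -> : injective_norm (fun b a => ten a b) t = injective_norm ten t by [].
congr sup; apply/seteqP; split=> r [f [g [s [f1 g1 ts rE]]]].
  exists g, f, [seq (p.2, p.1) | p <- s]; rewrite !big_map; split=> //.
  by rewrite rE; congr `|_|; apply: eq_bigr => p _; rewrite mulrC.
exists g, f, [seq (p.2, p.1) | p <- s]; rewrite !big_map; split=> //.
by rewrite rE; congr `|_|; apply: eq_bigr => p _; rewrite mulrC.
Qed.

(** * Slices, the two embeddings and separation of characters *)

Section Slice.
Context {R : realType} {A B : comBanachAlg R[i]}.

Lemma gelfand_dual_unit_ball (psi : maxspace B) :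
  dual_unit_ball (fun b : B => gelfand b psi).
Proof. by split; [exact: gelfand_scalar|exact: gelfand_norm_le]. Qed.

Lemma tensor_slice (T : comAlgType R[i]) (ten : A -> B -> T) (N : T -> R[i])
    (psi : maxspace B) :
  is_tensor_algebra ten -> is_tomiyama_norm ten N ->
  exists g : {linear T -> A}, [/\ forall s t, g (s * t) = g s * g t,
    forall a, g (ten a 1) = a & forall t, `|g t| <= N t].
Proof.
move=> [tenP ten1 tenM] [_ _ _ Ninj]; have [[tenl tenr] univ] := tenP.
pose f a b : A := gelfand b psi *: a.
have f_bil : bilinear_for *:%R *:%R f.
  split=> [b k a a'|a k b b'] /=; rewrite /f.
    by rewrite scalerDr !scalerA mulrC.
  by rewrite gelfand_scalar scalerDl scalerA.
have [g0 [[/linear_bundle[g gg0] g0f] _]] := univ _ _ f_bil.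
have gf a b : g (ten a b) = f a b by rewrite gg0 g0f.
have gE (s : seq (A * B)) :
    g (\sum_(p <- s) ten p.1 p.2) = \sum_(p <- s) gelfand p.2 psi *: p.1.
  by rewrite linear_sum; apply: eq_bigr => p _; exact: gf.
exists g; split=> [s t|a|t].
- have [s' ->] := tensor_product_span s tenP.
  have [t' ->] := tensor_product_span t tenP.
  rewrite !gE !mulr_suml linear_sum/=; apply: eq_bigr => p _.
  rewrite !mulr_sumr linear_sum; apply: eq_bigr => q _.
  by rewrite tenM gf /f gelfandM -scalerAl -scalerAr scalerA.
- by rewrite gf /f gelfand1 scale1r.
(* With [fA] norming [g t], the value $f_A(g(t)) = \sum f_A(a)\psi(b)$ is controlled by the
   injective norm, hence by [N t]. *)
- have [fA fA1 fAg] := hahn_banach (g t).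
  apply: le_trans fAg _; have [s ts] := tensor_product_span t tenP.
  apply: le_trans (Ninj t); rewrite {2}ts.
  have := injective_norm_ge s tenP fA1 (gelfand_dual_unit_ball psi).
  apply: le_trans.
  have [h hfA] := linear_bundle (fA1.1 : linear (fA : A -> R[i]^o)).
  rewrite ts gE -hfA linear_sum.
  rewrite le_eqVlt; apply/orP; left; apply/eqP; congr `|_|.
  apply: eq_bigr => p _.
  by rewrite linearZ hfA; exact: mulrC.
Qed.

End Slice.

Lemma algebra_dense_extension {R : realType} (T : comAlgType R[i])
    (C A : comBanachAlg R[i]) (i : {lrmorphism T -> C})
    (g : {linear T -> A}) :
  dense (range i) -> (forall s t, g (s * t) = g s * g t) ->
  (forall t, `|g t| <= `|i t|) ->
  exists S : {linear C -> A}, [/\ forall c d, S (c * d) = S c * S d,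
    forall c, `|S c| <= `|c| & forall t, S (i t) = g t].
Proof.
move=> di gM gi; have [S0 S0P] := dense_extension di gi.
have S0i t : S0 (i t) = g t.
  apply/eqP; rewrite -subr_eq0 -normr_le0.
  by apply: le_trans (S0P _ _) _; rewrite subrr normr0.
have S0_lin : linear S0.
  move=> k c d; apply/eqP; rewrite -subr_eq0; apply/eqP.
  have [r kr] : exists r : R, `|k| = r%:C.
    by exists (complex.Re `|k|); rewrite RRe_real ?normr_real.
  (* Both sides lie within $|k|\,\|c - i(t)\| + \|d - i(s)\| \le (r + 1)e$ of $g(kt + s)$. *)
  apply: (norm_small_eq0 (M := 2 * (r + 1))) => e e0.
  have [t ct] := dense_norm_lt c di e0.
  have [s ds] := dense_norm_lt d di e0.
  pose B := `|k| * `|c - i t| + `|d - i s|.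
  apply: le_trans (_ : B + B <= _).
    rewrite -(subrKA (g (k *: t + s))); apply: le_trans (ler_normD _ _) _.
    apply: lerD.
      apply: le_trans (S0P _ _) _; rewrite linearP opprD addrACA -scalerBr.
      by apply: le_trans (ler_normD _ _) _; rewrite normrZ.
    rewrite linearP opprD addrACA -scalerBr; apply: le_trans (ler_normD _ _) _.
    by rewrite normrZ lerD ?ler_wpM2l// distrC S0P.
  rewrite -mulrA mulr_natl mulr2n mulrDl mul1r [leRHS]rmorphD.
  suff BM : B <= (r * e + e)%:C by exact: lerD.
  by rewrite rmorphD rmorphM/= -kr lerD ?ler_wpM2l// ltW.
have [S S_E] := linear_bundle S0_lin.
have Sle c : `|S c| <= `|c|.
  by have := S0P c 0; rewrite !linear0 !addr0 S_E.
have Si t : S (i t) = g t by rewrite S_E.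
have SP c t : `|S c - g t| <= `|c - i t| by rewrite S_E S0P.
have normM (D : comBanachAlg R[i]) (x y : D) : `|x * y| <= `|x| * `|y|.
  exact: banach_normM_le.
(* Multiplicativity is extended one factor at a time: first with the second factor in the range of
   [i], then for arbitrary [d] by approximation. *)
have SMi c s : S (c * i s) = S c * g s.
  apply/eqP; rewrite -subr_eq0; apply/eqP.
  apply: (norm_small_eq0 (M := complex.Re `|i s| + complex.Re `|g s|)) => e e0.
  have [t ct] := dense_norm_lt c di e0.
  rewrite -(subrKA (g t * g s)); apply: le_trans (ler_normD _ _) _.
  rewrite mulrDl rmorphD !rmorphM/= !Re_normK -mulrBl.
  have {1}-> : g t * g s = S (i t * i s) by rewrite -rmorphM Si gM.
  rewrite -linearB -mulrBl; apply: lerD.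
    apply: le_trans (Sle _) _; apply: le_trans (normM _ _ _) _.
    by rewrite mulrC ler_wpM2l// ltW.
  apply: le_trans (normM _ _ _) _; rewrite mulrC ler_wpM2l//.
  by rewrite distrC; apply: le_trans (SP _ _) _; exact: ltW.
exists S; split=> // c d.
apply/eqP; rewrite -subr_eq0; apply/eqP.
apply: (norm_small_eq0 (M := complex.Re `|c| + complex.Re `|S c|)) => e e0.
have [s ds] := dense_norm_lt d di e0.
rewrite -(subrKA (S (c * i s))); apply: le_trans (ler_normD _ _) _.
rewrite mulrDl rmorphD !rmorphM/= !Re_normK.
rewrite -linearB -mulrBr SMi -mulrBr; apply: lerD.
  apply: le_trans (Sle _) _; apply: le_trans (normM _ _ _) _.
  by rewrite ler_wpM2l// ltW.
apply: le_trans (normM _ _ _) _; rewrite ler_wpM2l//.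
by rewrite distrC; apply: le_trans (SP _ _) _; exact: ltW.
Qed.

Lemma tomiyama_slice {R : realType} (A B C : comBanachAlg R[i])
    (psi : maxspace B) :
  tomiyama_product A B C ->
  exists S : {linear C -> A}, [/\ forall c d, S (c * d) = S c * S d,
    forall c, `|S c| <= `|c| & forall a, exists c, S c = a].
Proof.
move=> [T [ten [N [tenP NP [iota iotaN di]]]]].
have [g [gM ga gN]] := tensor_slice psi tenP NP.
have [|S [SM S1 Si]] := algebra_dense_extension di gM.
  by move=> t; rewrite iotaN.
by exists S; split=> // a; exists (iota (ten a 1)); rewrite Si.
Qed.

Lemma tomiyama_embedding {R : realType} (A B C : comBanachAlg R[i]) :
  tomiyama_product A B C ->
  exists (iA : {linear A -> C}) (iB : {linear B -> C}) (MA MB : R[i]),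
  [/\ [/\ forall a a', iA (a * a') = iA a * iA a',
          forall b b', iB (b * b') = iB b * iB b', iA 1 = 1 & iB 1 = 1],
      forall a, `|iA a| <= MA * `|a|, forall b, `|iB b| <= MB * `|b| &
      forall phi psi : maxspace C,
        (forall a, gelfand (iA a) phi = gelfand (iA a) psi) ->
        (forall b, gelfand (iB b) phi = gelfand (iB b) psi) -> phi = psi].
Proof.
move=> [T [ten [N [[tenP ten1 tenM] [Nn NM Nx Ninj] [iota iotaN di]]]]].
have [[tenl tenr] univ] := tenP.
have [iA iAE] : exists h : {linear A -> C}, h =1 (fun a => iota (ten a 1)).
  by apply: linear_bundle => k a a'; rewrite /= tenl linearP.
have [iB iBE] : exists h : {linear B -> C}, h =1 (fun b => iota (ten 1 b)).
  by apply: linear_bundle => k a a'; rewrite /= tenr linearP.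
(* By the cross norm property $\|a \otimes 1\| = \|a\|\,\|1\|$, and units may have norm other than
   1. *)
exists iA, iB, `|1 : B|, `|1 : A|; split.
- split=> [a a'|b b'||].
  + by rewrite !iAE -rmorphM tenM mulr1.
  + by rewrite !iBE -rmorphM tenM mulr1.
  + by rewrite iAE ten1 rmorph1.
  + by rewrite iBE ten1 rmorph1.
- by move=> a; rewrite iAE iotaN Nx mulrC.
- by move=> b; rewrite iBE iotaN Nx.
move=> phi psi phiA phiB; apply: val_inj; apply/funext => c.
rewrite -[LHS]/(gelfand c phi) -[RHS]/(gelfand c psi).
have iotaE t : gelfand (iota t) phi = gelfand (iota t) psi.
  have [s ->] := tensor_product_span t tenP.
  rewrite linear_sum/=; elim: s => [|p s IHs].
    by rewrite !big_nil !gelfand0.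
  rewrite !big_cons !gelfandD IHs; congr (_ + _).
  have -> : iota (ten p.1 p.2) = iA p.1 * iB p.2.
    by rewrite iAE iBE -rmorphM tenM mulr1 mul1r.
  by rewrite !gelfandM phiA phiB.
apply/eqP; rewrite -subr_eq0; apply/eqP.
(* Replacing [c] by [iota t] costs at most [e] for each of the two contractive characters. *)
apply: (norm_small_eq0 (V := R[i]^o) (M := 2)) => e e0.
have [t ct] := dense_norm_lt c di e0.
rewrite -(subrKA (gelfand (iota t) phi)) {2}iotaE.
apply: le_trans (ler_normD _ _) _.
rewrite -!gelfandB mulr_natl mulr2n rmorphD/=.
by apply: lerD; apply: le_trans (gelfand_norm_le _ _) _; rewrite ltW// distrC.
Qed.

(** * Maximal ideal spaces and relative units *)

Lemma separated_hausdorff {X Y : topologicalType} {I : Type} (f : I -> X -> Y) :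
  hausdorff_space Y -> (forall i, continuous (f i)) ->
  (forall x y, (forall i, f i x = f i y) -> x = y) -> hausdorff_space X.
Proof.
move=> hY fc fI x y clxy; apply: fI => i; apply: hY => U V Ux Vy.
have [z [Uz Vz]] := clxy _ _ (fc i _ _ Ux) (fc i _ _ Vy).
by exists (f i z).
Qed.

(** * The weak-star topology and transfer of relative units *)

Section MaxspaceTopology.
Context {R : realType}.

Lemma gelfand_continuous (D : comBanachAlg R[i]) (a : D) :
  continuous (gelfand a : maxspace D -> R[i]^o).
Proof.
move=> phi.
apply: (@continuous_comp (maxspace D) {ptws D -> R[i]^o} R[i]^o
  set_val (fun f => f a)).
  exact: initial_continuous.
have : {ptws, nbhs (set_val phi : {ptws D -> R[i]^o}) -->
    (set_val phi : {ptws D -> R[i]^o})} by [].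
by rewrite pointwise_cvgP; apply.
Qed.

Lemma continuous_maxspace (X : topologicalType) (D : comBanachAlg R[i])
    (F : X -> maxspace D) :
  (forall a, continuous (fun x => gelfand a (F x) : R[i]^o)) -> continuous F.
Proof.
move=> Fc; apply: continuous_comp_initial => x.
suff : {ptws, (set_val \o F) @ x -->
    (set_val (F x) : {ptws D -> R[i]^o})} by [].
by rewrite pointwise_cvgP => a; exact: Fc.
Qed.

Lemma gelfand_inj (D : comBanachAlg R[i]) (phi psi : maxspace D) :
  (forall a, gelfand a phi = gelfand a psi) -> phi = psi.
Proof. by move=> e; apply: val_inj; apply/funext => a; exact: e. Qed.

Lemma maxspace_pullback (C A : comBanachAlg R[i]) (S : {linear C -> A}) :
  (forall c d, S (c * d) = S c * S d) -> (exists c, S c = 1) ->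
  exists F : maxspace A -> maxspace C,
    continuous F /\ forall phi c, gelfand c (F phi) = gelfand (S c) phi.
Proof.
move=> SM [c0 Sc0].
have SP (phi : maxspace A) :
    (fun c => gelfand (S c) phi : R[i]^o) \in characters C.
  apply/mem_set; split=> [k c d|c d|].
  - by rewrite linearP gelfand_scalar.
  - by rewrite SM gelfandM.
  - by exists c0; rewrite Sc0 gelfand1 oner_neq0.
pose F phi : maxspace C := SigSub (SP phi).
exists F; split=> //; apply: continuous_maxspace => c.
exact: gelfand_continuous.
Qed.

(** Local vanishing is the form of membership in [Jideal] that pulls back along continuous maps. *)
Lemma notin_suppP (D : comBanachAlg R[i]) (a : D) (phi : maxspace D) :
  ~ supp a phi <-> \forall chi \near phi, gelfand a chi = 0.
Proof.
split=> [|a0 sa].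
  move=> /existsNP[U] /not_implyP[Uphi] /set0P/negP/negPn/eqP U0.
  apply: filterS Uphi => chi Uchi; apply: contrapT => /eqP ac0.
  by have : set0 chi by rewrite -U0.
by have [chi [/=/eqP]] := sa _ a0.
Qed.

Lemma bounded_relative_units_quotient (C A : comBanachAlg R[i])
    (S : {linear C -> A}) :
  (forall c d, S (c * d) = S c * S d) -> (forall c, `|S c| <= `|c|) ->
  (forall a, exists c, S c = a) ->
  bounded_relative_units C -> bounded_relative_units A.
Proof.
move=> SM Sle Ssurj bruC phi.
have [F [Fc FE]] := maxspace_pullback SM (Ssurj 1).
have [m m0 bruP] := bruC (F phi); exists m => // L Lcomp Lphi.
have [||c [Jc c1 cm]] := bruP (F @` L).
- exact/continuous_compact/Lcomp/continuous_subspaceT.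
(* Surjectivity of [S] makes the pullback injective, so the image of [L] misses [F phi]. *)
- move=> _ [chi Lchi <-] /= Fchi; apply: (Lphi _ Lchi) => /=.
  by apply: gelfand_inj => a; have [c <-] := Ssurj a; rewrite -!FE Fchi.
exists (S c); split; last exact: le_trans (Sle c) cm.
  apply/notin_suppP; have c0 : \forall chi \near phi, gelfand c (F chi) = 0.
    by have /notin_suppP/Fc := Jc.
  by apply: filterS c0 => chi /=; rewrite FE.
move=> _ [chi Lchi <-]; rewrite -FE; apply: c1.
by exists (F chi) => //; exists chi.
Qed.

Lemma bounded_relative_units_generated (A B C : comBanachAlg R[i])
    (iA : {linear A -> C}) (iB : {linear B -> C}) (MA MB : R[i]) :
  (forall a a', iA (a * a') = iA a * iA a') ->
  (forall b b', iB (b * b') = iB b * iB b') -> iA 1 = 1 -> iB 1 = 1 ->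
  0 <= MA -> 0 <= MB ->
  (forall a, `|iA a| <= MA * `|a|) -> (forall b, `|iB b| <= MB * `|b|) ->
  (forall phi psi : maxspace C,
    (forall a, gelfand (iA a) phi = gelfand (iA a) psi) ->
    (forall b, gelfand (iB b) phi = gelfand (iB b) psi) -> phi = psi) ->
  bounded_relative_units A -> bounded_relative_units B ->
  bounded_relative_units C.
Proof.
move=> iAM iBM iA1 iB1 MA0 MB0 iAle iBle gen bruA bruB theta.
have [FA [FAc FAE]] := maxspace_pullback iAM (ex_intro _ 1 iA1).
have [FB [FBc FBE]] := maxspace_pullback iBM (ex_intro _ 1 iB1).
have [m m0 mP] := bruA (FA theta); have [n n0 nP] := bruB (FB theta).
(* The first three terms bound $a + b - ab$ in [C]; the last makes [M] positive even when [MA] and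
   [MB] vanish. *)
pose M := MA * m + MB * n + (MA * m) * (MB * n) + 1.
have M0 : 0 < M by rewrite ltr_wpDl// !addr_ge0 ?mulr_ge0// ltW.
exists M => // L Lcomp Ltheta.
pose F chi := (FA chi, FB chi).
have Fc : continuous F by move=> chi; exact: (cvg_pair (FAc chi) (FBc chi)).
have hausAB : hausdorff_space (maxspace A * maxspace B)%type.
  pose f (i : A + B) (x : maxspace A * maxspace B) : R[i]^o :=
    match i with inl a => gelfand a x.1 | inr b => gelfand b x.2 end.
  apply: (@separated_hausdorff _ _ _ f) => [|[a|b]|[x1 x2] [y1 y2] fxy].
  - exact: norm_hausdorff.
  - move=> x; apply: (continuous_comp (@cvg_fst _ _ _ _ _)).
    exact: gelfand_continuous.
  - move=> x; apply: (continuous_comp (@cvg_snd _ _ _ _ _)).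
    exact: gelfand_continuous.
  - by congr pair; apply: gelfand_inj => c;
      [exact: (fxy (inl c))|exact: (fxy (inr c))].
have FLclosed : closed (F @` L).
  apply: compact_closed => //.
  exact/continuous_compact/Lcomp/continuous_subspaceT.
have [[U V] [/= Uth Vth] UVL] : nbhs (F theta) (~` (F @` L)).
  apply: open_nbhs_nbhs; split; first exact: closed_openC.
  move=> [chi Lchi] [FAchi FBchi]; apply: (Ltheta _ Lchi) => /=.
  by apply: gen => c; rewrite -?FAE -?FBE ?FAchi ?FBchi.
have closedN (X Y : topologicalType) (G : X -> Y) (W : set Y) : continuous G ->
    closed (G @^-1` (~` W^°)).
  move=> Gc; apply: closed_comp => [x _|]; first exact: Gc.
  by apply: open_closedC; exact: open_interior.
(* Interiors make this part of [L] closed, hence compact; its projection avoids [FA theta], which is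
   interior to [U]. *)
have [||a [Ja a1 am]] := mP (FA @` (L `&` FA @^-1` (~` U^°))).
- apply: continuous_compact; first exact: continuous_subspaceT.
  by apply: compact_closedI Lcomp _; exact: closedN FAc.
- by move=> _ [chi [_ nU] <-] /= FAchi; apply: nU; rewrite /= FAchi.
have [||b [Jb b1 bn]] := nP (FB @` (L `&` FB @^-1` (~` V^°))).
- apply: continuous_compact; first exact: continuous_subspaceT.
  by apply: compact_closedI Lcomp _; exact: closedN FBc.
- by move=> _ [chi [_ nV] <-] /= FBchi; apply: nV; rewrite /= FBchi.
have gE chi : gelfand (iA a + iB b - iA a * iB b) chi =
    gelfand a (FA chi) + gelfand b (FB chi) -
      gelfand a (FA chi) * gelfand b (FB chi).
  by rewrite gelfandB gelfandD gelfandM FAE FBE.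
exists (iA a + iB b - iA a * iB b); split.
- apply/notin_suppP; 
  have aJ : \forall chi \near theta, gelfand a (FA chi) = 0.
    by have /notin_suppP/FAc := Ja.
  have bJ : \forall chi \near theta, gelfand b (FB chi) = 0.
    by have /notin_suppP/FBc := Jb.
  by apply: filterS2 aJ bJ => chi a0 b0; rewrite gE a0 b0 mul0r !addr0 subr0.
- move=> _ [chi Lchi <-] /=; rewrite gE.
  (* As $a + b - ab = 1 - (1 - a)(1 - b)$, one factor with value 1 suffices. *)
  have [Uchi|nUchi] := pselect (U^° (FA chi)); last first.
    rewrite (a1 (gelfand a (FA chi))); last first.
      by exists (FA chi) => //; exists chi.
    by rewrite mul1r addrK.
  have [Vchi|nVchi] := pselect (V^° (FB chi)); last first.
    rewrite (b1 (gelfand b (FB chi))); last first.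
      by exists (FB chi) => //; exists chi.
    by rewrite mulr1 addrAC subrr add0r.
  case: (UVL (F chi)); last by exists chi.
  by split; apply: nbhs_singleton.
- have iAm : `|iA a| <= MA * m by apply: le_trans (iAle a) _; rewrite ler_wpM2l.
  have iBn : `|iB b| <= MB * n by apply: le_trans (iBle b) _; rewrite ler_wpM2l.
  apply: le_trans (ler_normB _ _) _; rewrite /M -[leLHS]addr0 lerD//.
  apply: lerD; first by apply: le_trans (ler_normD _ _) _; exact: lerD.
  by apply: le_trans (banach_normM_le _ _) _; exact: ler_pM.
Qed.

End MaxspaceTopology.

(** On an empty character space all Gelfand transforms coincide, so injectivity would give $1 =
    0$. *)
Lemma semisimple_maxspace {K : numFieldType} (D : comBanachAlg K) :
  semisimple D -> exists phi : maxspace D, True.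
Proof.
move=> ssD; apply: contrapT => /forallNP noM.
have /eqP[] := oner_neq0 D; apply: ssD; apply/funext => phi.
by case: (noM phi).
Qed.

Theorem corollary3p2 (R : realType) (A B C : comBanachAlg R[i])
    (hA : semisimple A) (hB : semisimple B)
    (hC : semisimple C) (hAB : tomiyama_product A B C) :
  bounded_relative_units C <->
  bounded_relative_units A /\ bounded_relative_units B.
Proof.
split=> [bruC|[bruA bruB]].
  have [phi _] := semisimple_maxspace hA.
  have [psi _] := semisimple_maxspace hB.
  have [S [SM Sle Ssurj]] := tomiyama_slice psi hAB.
  have [S' [SM' Sle' Ssurj']] := tomiyama_slice phi (tomiyama_product_sym hAB).
  split; first exact: (bounded_relative_units_quotient SM).
  exact: (bounded_relative_units_quotient SM').
have [iA [iB [MA [MB [[iAM iBM iA1 iB1] iAle iBle gen]]]]] :=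
  tomiyama_embedding hAB.
(* The bound at the unit, whose norm is positive, fixes the sign of the constant. *)
have M0 (D : comBanachAlg R[i]) (i : {linear D -> C}) (M : R[i]) :
    (forall a, `|i a| <= M * `|a|) -> 0 <= M.
  move=> /(_ 1)/(le_trans (normr_ge0 _)).
  by rewrite pmulr_lge0// normr_gt0 oner_neq0.
by apply: (bounded_relative_units_generated iAM iBM iA1 iB1 _ _ iAle iBle gen)
  => //; exact: M0.
Qed.
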